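(* Let $A,B,C$ be real matrices of sizes $n\times n$, $n\times r$, $r\times n$ (equal numbers of inputs and outputs), with $\operatorname{rank}B=r$ and $(A,B)$ controllable with controllability index $\nu$, and suppose the system matrix $P(s)=\begin{bmatrix} sI_n-A & -B \\ C & O \end{bmatrix}$ has normal rank $n+r$. Then the system zeros of $\dot x=Ax+Bu$, $y=Cx$ are the zeros of the polynomial $$\psi(s)=s^{\,n-r\nu}\det\tilde C(s),$$ where $\tilde C(s)=[O,C_1]+[O,C_2]s+\cdots+[O,C_{\nu-1}]s^{\nu-2}+C_\nu s^{\nu-1}$ is the $r\times r$ matrix polynomial obtained from the Yokoyama canonical form of the system as in the context.
   Context: Controllability index: the smallest $\nu$ with $\operatorname{rank}[B,AB,\dots,A^{\nu-1}B]=\operatorname{rank}[B,\dots,A^{n-1}B]$. Integers $l_1\le l_2\le\cdots\le l_\nu=r$ are defined by $l_\nu=\operatorname{rank}B$ and $l_{\nu-k}=\operatorname{rank}[B,AB,\dots,A^{k}B]-\operatorname{rank}[B,AB,\dots,A^{k-1}B]$, $k=1,\dots,\nu-1$; then $l_1+\cdots+l_\nu=n$. Yokoyama canonical form: there are a nonsingular $n\times n$ matrix $N$ and an $r\times r$ permutation matrix $M$ such that $$NAN^{-1}=F=\begin{bmatrix} O & E_{1,2} & O & \cdots & O \\ O & O & E_{2,3} & \cdots & O \\ \vdots & & & \ddots & \vdots \\ O & O & O & \cdots & E_{\nu-1,\nu} \\ F_{\nu 1} & F_{\nu 2} & F_{\nu 3} & \cdots & F_{\nu\nu} \end{bmatrix},\qquad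 NBM=\begin{bmatrix} O \\ G_\nu \end{bmatrix},$$ with block sizes $l_1,\dots,l_\nu$, $E_{i,i+1}=[O,I_{l_i}]$ of size $l_i\times l_{i+1}$, and $G_\nu$ an $r\times r$ lower triangular matrix with unit diagonal. Fix such $N,M$ and partition $CN^{-1}=[C_1,\dots,C_\nu]$ with $C_i$ having $l_i$ columns. $[O,C_i]$ denotes $C_i$ padded on the left by zero columns to have $r$ columns. System zeros: among the minors of $P(s)$ formed by rows $1,\dots,n,n+i_1,\dots,n+i_k$ and columns $1,\dots,n,n+j_1,\dots,n+j_k$, take those of the largest order that are not identically zero; the system zeros are the zeros of their greatest common divisor. (In the present square case with normal rank $n+r$ this is $\det P(s)$.) *)

(* Defs.v *)
From HB Require Import structures.
From mathcomp Require Export all_boot all_order all_algebra.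
From mathcomp Require Export reals complex.
Set Implicit Arguments.
Unset Strict Implicit.
Unset Printing Implicit Defensive.
Import Order.TTheory GRing.Theory Num.Theory.
Local Open Scope ring_scope.

Section Controllability.
Variables (R : fieldType) (n r : nat).
Implicit Types (A : 'M[R]_n) (B : 'M[R]_(n, r)).

(* [B, A B, ..., A^(k-1) B] *)
Definition ctrb_mx A B (k : nat) : 'M[R]_(n, \sum_(j < k) r) :=
  \mxrow_(j < k) (A ^+ j *m B).

Definition controllable A B : Prop := \rank (ctrb_mx A B n) = n.

Fact ctrb_index_ex A B :
  exists nu, \rank (ctrb_mx A B nu) == \rank (ctrb_mx A B n).
Proof. by exists n. Qed.

Definition ctrb_index A B : nat := ex_minn (ctrb_index_ex A B).

(* ctrb_incr A B k is l_(nu-k). *)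
Definition ctrb_incr A B (k : nat) : nat :=
  if k is 0 then \rank B
  else (\rank (ctrb_mx A B k.+1) - \rank (ctrb_mx A B k))%N.

(* Indices start at 0: blk A B i is l_(i+1). *)
Definition blk A B (i : 'I_(ctrb_index A B)) : nat :=
  ctrb_incr A B (ctrb_index A B - i.+1).
Arguments blk : clear implicits.

Lemma rank_ctrb_leqS A B k :
  (\rank (ctrb_mx A B k) <= \rank (ctrb_mx A B k.+1))%N.
Proof.
rewrite -mxrank_tr -[X in (_ <= X)%N]mxrank_tr; apply: mxrankS.
rewrite /ctrb_mx !tr_mxrow !eqmx_col; apply/sumsmx_subP => i _.
exact: (sumsmx_sup (widen_ord (leqnSn k) i)).
Qed.

Lemma rank_ctrb1 A B : \rank (ctrb_mx A B 1) = \rank B.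
Proof.
rewrite -mxrank_tr -[RHS]mxrank_tr /ctrb_mx tr_mxrow eqmx_col.
by rewrite big_ord1 expr0 mul1mx genmxE.
Qed.

Lemma rank_ctrb0 A B : \rank (ctrb_mx A B 0) = 0%N.
Proof.
by apply/eqP; rewrite -leqn0 (leq_trans (rank_leq_col _)) // big_ord0.
Qed.

Lemma sum_blk A B : controllable A B -> (\sum_i blk A B i = n)%N.
Proof.
move=> cAB; rewrite (reindex_inj rev_ord_inj) /=.
have sumE k : (\sum_(i < k) ctrb_incr A B i = \rank (ctrb_mx A B k))%N.
  elim: k => [|k IHk]; first by rewrite big_ord0 rank_ctrb0.
  rewrite big_ord_recr /= IHk; case: k {IHk} => [|k] /=.
    by rewrite rank_ctrb0 rank_ctrb1.
  by rewrite subnKC ?rank_ctrb_leqS.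
rewrite (eq_bigr (fun i : 'I_(ctrb_index A B) => ctrb_incr A B i)).
  by rewrite sumE /ctrb_index; case: ex_minnP => nu /eqP -> _.
by move=> i _; rewrite /blk /= subnSK // subKn // ltnW.
Qed.

End Controllability.

Arguments blk {R n r} A B i.

Section Yokoyama.
Variables (R : fieldType) (n r : nat) (A : 'M[R]_n) (B : 'M[R]_(n, r)).

(* [O, X] with q columns in total. For p <= q the row block has q columns and
   conform_mx is a cast; it is not meaningful for p > q, where it is 0. *)
Definition padl (m p q : nat) (X : 'M[R]_(m, p)) : 'M[R]_(m, q) :=
  conform_mx 0 (row_mx (0 : 'M_(m, q - p)) X).

Hypothesis cAB : controllable A B.

Definition eqn_blk : n = (\sum_i blk A B i)%N := esym (sum_blk cAB).

(* The last block row of N A N^-1 is left arbitrary. The last block of N B M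
   has l_nu = rank B rows, that is, r rows when B has full column rank. *)
Definition yokoyama_form (N : 'M[R]_n) (M : 'M[R]_r) : Prop :=
  [/\ N \in unitmx,
      is_perm_mx M,
      forall i j : 'I_(ctrb_index A B), (i.+1 < ctrb_index A B)%N ->
        submxblock (castmx (eqn_blk, eqn_blk) (N *m A *m invmx N)) i j =
        if j == i.+1 :> nat then padl (blk A B j) (1%:M : 'M_(blk A B i))
        else 0,
      forall i : 'I_(ctrb_index A B), (i.+1 < ctrb_index A B)%N ->
        submxcol (castmx (eqn_blk, erefl r) (N *m B *m M)) i = 0 &
      forall i : 'I_(ctrb_index A B), i.+1 = ctrb_index A B ->
        let G := submxcol (castmx (eqn_blk, erefl r) (N *m B *m M)) i in
        is_trig_mx G /\
        (forall (a : 'I_(blk A B i)) (b : 'I_r), a = b :> nat -> G a b = 1)].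

Definition yoko_C (m : nat) (C : 'M[R]_(m, n)) (N : 'M[R]_n)
    (i : 'I_(ctrb_index A B)) : 'M[R]_(m, blk A B i) :=
  submxrow (castmx (erefl m, eqn_blk) (C *m invmx N)) i.

Definition C_tilde (m : nat) (C : 'M[R]_(m, n)) (N : 'M[R]_n) :
    'M[{poly R}]_(m, r) :=
  \sum_(i < ctrb_index A B) 'X^i *: map_mx polyC (padl r (yoko_C C N i)).

End Yokoyama.

Section SystemZeros.
Variables (R : fieldType) (n r m : nat).
Variables (A : 'M[R]_n) (B : 'M[R]_(n, r)) (C : 'M[R]_(m, n)).

Definition system_mx : 'M[{poly R}]_(n + m, n + r) :=
  block_mx ('X%:M - map_mx polyC A) (- map_mx polyC B) (map_mx polyC C) 0.

Definition normal_rank : nat :=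
  \rank (map_mx (@tofrac {poly R}) system_mx).

(* The indices 1, ..., n, n + f_1, ..., n + f_k. *)
Definition border (k p : nat) (f : {ffun 'I_k -> 'I_p}) (i : 'I_(n + k)) :
    'I_(n + p) :=
  match split i with inl a => lshift p a | inr b => rshift n (f b) end.

Definition incr (k p : nat) (f : {ffun 'I_k -> 'I_p}) : bool :=
  [forall i : 'I_k, forall j : 'I_k, (i < j)%N ==> (f i < f j)%N].

Definition bminor (k : nat) (f : {ffun 'I_k -> 'I_m})
    (g : {ffun 'I_k -> 'I_r}) : {poly R} :=
  \det (mxsub (border f) (border g) system_mx).

Definition has_bminor (k : nat) : bool :=
  [exists f : {ffun 'I_k -> 'I_m}, exists g : {ffun 'I_k -> 'I_r},
     [&& incr f, incr g & bminor f g != 0]].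

(* The largest number k of bordering rows and columns; k = 0 always occurs. *)
Definition max_bminor : nat :=
  \max_(k < (minn m r).+1 | has_bminor k) k.

Definition system_zero_poly : {poly R} :=
  \big[@gcdp R/0]_(f : {ffun 'I_max_bminor -> 'I_m} | incr f)
    \big[@gcdp R/0]_(g : {ffun 'I_max_bminor -> 'I_r} |
        incr g && (bminor f g != 0)) bminor f g.

End SystemZeros.

(* Zeros are complex and are counted with multiplicity. *)
Section ComplexZeros.
Variable R : rcfType.

Definition complex_poly (p : {poly R}) : {poly R[i]} :=
  map_poly (real_complex R) p.

Definition is_zero (p : {poly R}) (z : R[i]) : bool := root (complex_poly p) z.

Definition zero_mult (p : {poly R}) (z : R[i]) : nat := mup z (complex_poly p).

End ComplexZeros.

(* Main.v *)
Require Import Defs.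
From mathcomp Require Import zify.
Import Order.TTheory GRing.Theory Num.Theory.
Local Open Scope ring_scope.

(** Passing to the canonical coordinates multiplies [det P] by [det M = +-1],
and the state feedback cancelling the last block row of [F] leaves it unchanged
while replacing [F] by a strictly block upper triangular [F0], for which
[det (sI - F0) = s^n]. The matrix [X] with blocks [X_i = s^(i-1) [O, I]]
satisfies [(sI - F0) X = s^nu [O; I_r]] and [C X = C_tilde], so multiplying the
system matrix on the right by [[I, X], [O, s^nu G_nu^-1]] makes it block lower
triangular and gives [det P * s^(r nu) = s^n * det C_tilde] up to [det M].
The identities for [X] need [l_1 <= ... <= l_nu = r], i.e. that the rank
increments of the controllability matrices are nonincreasing. *)

(** * Padding by zero columns on the left *)

Lemma padlE (R : fieldType) m p q (X : 'M[R]_(m, p)) (i : 'I_m) (j : 'I_q) :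
  (p <= q)%N ->
  padl q X i j = \sum_(c < p) X i c *+ (j == (c + (q - p))%N :> nat).
Proof.
move=> le_pq; have e := subnK le_pq; rewrite /padl.
have -> : conform_mx 0 (row_mx (0 : 'M_(m, q - p)) X)
    = castmx (erefl m, e) (row_mx 0 X).
  by rewrite -(conform_castmx (erefl m, e)) conform_mx_id.
rewrite castmxE /= cast_ord_id.
set k := cast_ord _ j; have jk : j = k :> nat by [].
rewrite jk; case: (splitP k) => [a ka | a ka].
  have -> : k = lshift p a by apply: val_inj.
  rewrite row_mxEl mxE big1 // => c _ /=.
  by rewrite ltn_eqF // ltn_addl.
have -> : k = rshift (q - p) a by apply: val_inj.
rewrite row_mxEr (bigD1 a) //= [in X in _ = X + _]addnC eqxx mulr1n.
rewrite big1 ?addr0 // => c ca; rewrite addnC eqn_add2r eq_sym.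
by rewrite -[_ == _ :> nat]/(c == a) (negPf ca).
Qed.

Lemma mulmx_padl (R : fieldType) m k p q (Y : 'M[R]_(m, k)) (X : 'M[R]_(k, p)) :
  (p <= q)%N -> Y *m padl q X = padl q (Y *m X).
Proof.
move=> le_pq; apply/matrixP=> i j; rewrite padlE // !mxE.
under eq_bigr do rewrite padlE // mulr_sumr.
rewrite exchange_big; apply: eq_bigr => c _; rewrite mxE -sumrMnl.
by apply: eq_bigr => d _; rewrite mulrnAr.
Qed.

Lemma padl1E (R : fieldType) p q (i : 'I_p) (j : 'I_q) :
  (p <= q)%N ->
  padl q (1%:M : 'M[R]_p) i j = (j == (i + (q - p))%N :> nat)%:R.
Proof.
move=> le_pq; rewrite padlE // (bigD1 i) //= mxE eqxx big1 ?addr0 //.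
by move=> c ci; rewrite mxE eq_sym (negPf ci) mul0rn.
Qed.

(** Both factors keep the identity flush right, so the offsets [q - p] and [r - q] add up. This is
    why the superdiagonal blocks of [F0] carry block [i+1] of [X] to [s] times block [i]. *)
Lemma padl_padl1 (R : fieldType) p q r :
  (p <= q)%N -> (q <= r)%N ->
  padl q (1%:M : 'M[R]_p) *m padl r (1%:M : 'M_q) = padl r (1%:M : 'M_p).
Proof.
move=> le_pq le_qr; rewrite mulmx_padl // mulmx1.
apply/matrixP=> i j; rewrite padlE // padl1E ?(leq_trans le_pq) //.
have lt : (i + (q - p) < q)%N.
  by rewrite -[X in (_ < X)%N](subnKC le_pq) ltn_add2r.
rewrite (bigD1 (Ordinal lt)) //= padl1E // eqxx big1 ?addr0 => [|c ci].
  by rewrite -addnA [(q - p + _)%N]addnC addnBA // subnK.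
by rewrite padl1E // -[_ == _ :> nat]/(c == Ordinal lt) (negPf ci) mul0rn.
Qed.

Lemma map_polyC_mxM (R : comNzRingType) m n p (X : 'M[R]_(m, n))
    (Y : 'M_(n, p)) :
  map_mx polyC (X *m Y) = map_mx polyC X *m map_mx polyC Y.
Proof. exact: map_mxM. Qed.

(** * Determinant of a system in canonical form *)

Section ShiftSystem.
Variables (R : fieldType) (nu r : nat) (p : 'I_nu -> nat).
Hypothesis p_last : forall i : 'I_nu, i.+1 = nu -> p i = r.
Hypothesis p_homo : forall i j : 'I_nu, i.+1 = j -> (p i <= p j)%N.

Lemma p_le i : (p i <= r)%N.
Proof.
have [k] := ubnP (nu - i); elim: k i => // k IHk i; rewrite ltnS => lek.
have [lt|ge] := ltnP i.+1 nu.
  apply: (leq_trans (@p_homo i (Ordinal lt) erefl)); apply: IHk => /=.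
  by rewrite -(subnSK (ltn_ord i)) in lek.
by rewrite p_last //; apply/eqP; rewrite eqn_leq ltn_ord.
Qed.

(** This is [F0]: its last block row is 0 because no [j] equals [nu]. *)
Definition shift_mx : 'M[R]_(\sum_i p i) :=
  \mxblock_(i, j) (if j == i.+1 :> nat then padl (p j) 1%:M else 0).

(** This is [[O; I_r]]. [padl r] stands in for the identity, since the height [p i] of the last
    block is only propositionally equal to [r]. *)
Definition input_mx : 'M[R]_(\sum_i p i, r) :=
  \mxcol_i (if i.+1 == nu then padl r 1%:M else 0).

(** This is [X]; with indices from 0 the power [s^(i-1)] becomes ['X^i]. *)
Definition state_mx : 'M[{poly R}]_(\sum_i p i, r) :=
  \mxcol_i ('X^i *: map_mx polyC (padl r 1%:M)).

Lemma char_poly_shift_mx : char_poly shift_mx = 'X^(\sum_i p i).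
Proof.
(* The nonzero blocks lie strictly above the diagonal, while [is_trig_mx] means lower triangular;
   hence the transpose. *)
have tr : is_trig_mx shift_mx^T.
  rewrite /shift_mx tr_mxblock; apply/is_trig_mxblockP; split=> [i j lt_ij|i].
    by rewrite ltn_eqF ?trmx0 // ltnS ltnW.
  by rewrite ltn_eqF // trmx0 mx0_is_trig.
have diag k : shift_mx k k = 0.
  by rewrite mxE ltn_eqF // mxE.
have -> : char_poly shift_mx = char_poly shift_mx^T.
  rewrite /char_poly -det_tr; congr (\det _).
  by rewrite /char_poly_mx linearB /= tr_scalar_mx map_trmx.
rewrite char_poly_trig // -[in RHS](card_ord (\sum_i p i)) -prodr_const.
by apply: eq_bigr => k _; rewrite mxE diag subr0.
Qed.

Lemma char_poly_mx_shift_state :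
  char_poly_mx shift_mx *m state_mx = 'X^nu *: map_mx polyC input_mx.
Proof.
apply/mxcolP => i.
have -> : submxcol ('X^nu *: map_mx polyC input_mx) i
    = 'X^nu *: map_mx polyC (submxcol input_mx i).
  by apply/matrixP=> a b; rewrite !mxE.
rewrite mxcolK /char_poly_mx mulmxBl submxcolB mul_scalar_mx.
have -> : submxcol ('X *: state_mx) i = 'X^(i.+1) *: map_mx polyC (padl r 1%:M).
  have -> : submxcol ('X *: state_mx) i = 'X *: submxcol state_mx i.
    by apply/matrixP=> a b; rewrite !mxE.
  by rewrite mxcolK scalerA -exprS.
have -> : map_mx polyC shift_mx = \mxblock_(i, j) map_mx polyC
    (if j == i.+1 :> nat then padl (p j) (1%:M : 'M_(p i)) else 0).
  by apply/matrixP=> a b; rewrite !mxE.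
(* In the last block row [F0] vanishes and [s * s^(nu-1)] survives; in any other row the single
   block at [i+1] cancels ['X^i.+1]. *)
rewrite mul_mxblock_mxrow mxcolK; case: eqP => [i_last|i_nlast].
  rewrite i_last big1 ?subr0 // => j _.
  by rewrite ltn_eqF ?map_mx0 ?mul0mx // i_last.
have lt : (i.+1 < nu)%N by rewrite ltn_neqAle ltn_ord andbT; apply/eqP.
rewrite (bigD1 (Ordinal lt)) //= eqxx big1 => [|j].
  rewrite addr0 -scalemxAr -map_polyC_mxM padl_padl1 ?p_le ?p_homo //.
  by rewrite subrr map_mx0 scaler0.
by rewrite -val_eqE /= => /negPf ->; rewrite map_mx0 mul0mx.
Qed.

Lemma mul_state_mx m (C : 'M[R]_(m, \sum_i p i)) :
  map_mx polyC C *m state_mx =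
  \sum_(i < nu) 'X^i *: map_mx polyC (padl r (submxrow C i)).
Proof.
have -> : map_mx polyC C = \mxrow_i map_mx polyC (submxrow C i).
  by rewrite -{1}(submxrowK C); apply/matrixP=> a b; rewrite !mxE.
rewrite mul_mxrow_mxcol; apply: eq_bigr => i _.
by rewrite -scalemxAr -map_polyC_mxM mulmx_padl ?p_le // mulmx1.
Qed.

Lemma succ_neq_last (i j : 'I_nu) : i.+1 = nu -> j != i -> (j.+1 == nu) = false.
Proof.
move=> i_last; apply: contra_neqF => /eqP j_last.
by apply/val_inj/succn_inj; rewrite j_last i_last.
Qed.

(** [input_mx *m input_mx^T] is the projection onto the last block, and [Y] lives only there. *)
Lemma input_mx_proj m (Y : 'M[R]_(\sum_i p i, m)) :
  (forall i : 'I_nu, (i.+1 < nu)%N -> submxcol Y i = 0) ->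
  input_mx *m (input_mx^T *m Y) = Y.
Proof.
move=> Y0; rewrite /input_mx tr_mxcol -{1}(submxcolK Y) mul_mxrow_mxcol.
apply/mxcolP => i; rewrite mxcol_mul mxcolK.
have [i_last|i_nlast] := eqVneq i.+1 nu; last first.
  by rewrite mul0mx Y0 // ltn_neqAle i_nlast ltn_ord.
rewrite (bigD1 i) //= i_last eqxx big1 ?addr0 => [|j ji].
  rewrite mulmxA -[RHS]mul1mx; congr (_ *m _); apply/matrixP=> a b.
  have pr := p_last _ i_last; have z : (r - p i)%N = 0%N by rewrite pr subnn.
  rewrite mxE; under eq_bigr do
    rewrite [in X in _ * X]mxE !padl1E ?p_le // z !addn0.
  have ar : (a < r)%N by rewrite -pr.
  rewrite (bigD1 (Ordinal ar)) //= eqxx mul1r big1 ?addr0 ?mxE // => c ca.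
  by rewrite -[_ == _ :> nat]/(c == Ordinal ar) (negPf ca) mul0r.
by rewrite (succ_neq_last i) ?trmx0 ?mul0mx.
Qed.

(** Multiplying by [input_mx^T] extracts the last block of [G] as a square matrix: this is [G_nu],
    unit lower triangular. *)
Lemma det_tr_input_mx (i : 'I_nu) (G : 'M[R]_(\sum_i p i, r)) :
  i.+1 = nu -> is_trig_mx (submxcol G i) ->
  (forall (a : 'I_(p i)) (b : 'I_r), a = b :> nat -> submxcol G i a b = 1) ->
  \det (input_mx^T *m G) = 1.
Proof.
move=> i_last trG diagG.
have pr := p_last _ i_last; have z : (r - p i)%N = 0%N by rewrite pr subnn.
have entry (a b : 'I_r) :
    (input_mx^T *m G) a b = submxcol G i (cast_ord (esym pr) a) b.
  rewrite /input_mx tr_mxcol -{1}(submxcolK G) mul_mxrow_mxcol.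
  rewrite (bigD1 i) //= i_last eqxx big1 ?addr0 => [|j ji].
    rewrite mxE (bigD1 (cast_ord (esym pr) a)) //= mxE padl1E ?p_le //=.
    rewrite z addn0 eqxx mul1r big1 ?addr0 // => c ca.
    rewrite mxE padl1E ?p_le // z addn0.
    rewrite eq_sym -[_ == _ :> nat]/(c == cast_ord (esym pr) a).
    by rewrite (negPf ca) mul0r.
  by rewrite (succ_neq_last i) ?trmx0 ?mul0mx.
rewrite det_trig; first by apply: big1 => a _; rewrite entry diagG.
by apply/is_trig_mxP => a b lt_ab; rewrite entry; move/is_trig_mxP: trG; apply.
Qed.

Lemma det_system_mx_blocks (F : 'M[R]_(\sum_i p i)) (G : 'M[R]_(\sum_i p i, r))
    (C : 'M[R]_(r, \sum_i p i)) :
    (0 < nu)%N ->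
    (forall i j : 'I_nu, (i.+1 < nu)%N -> submxblock F i j =
       if j == i.+1 :> nat then padl (p j) (1%:M : 'M_(p i)) else 0) ->
    (forall i : 'I_nu, (i.+1 < nu)%N -> submxcol G i = 0) ->
    (forall i : 'I_nu, i.+1 = nu -> is_trig_mx (submxcol G i) /\
       (forall (a : 'I_(p i)) (b : 'I_r), a = b :> nat ->
         submxcol G i a b = 1)) ->
  \det (system_mx F G C) * 'X^(r * nu) =
  'X^(\sum_i p i) *
    \det (\sum_(i < nu) 'X^i *: map_mx polyC (padl r (submxrow C i))).
Proof.
move=> nu_gt0 F_blk G0 G_last.
have lt : (nu.-1 < nu)%N by rewrite prednK.
have i_last : (Ordinal lt).+1 = nu by rewrite /= prednK.
have [trG diagG] := G_last _ i_last.
have detG : \det (input_mx^T *m G) = 1 by apply: det_tr_input_mx trG diagG.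
have GE : input_mx *m (input_mx^T *m G) = G by apply: input_mx_proj.
move: (input_mx^T *m G) detG GE => Gn detG GE.
have Gu : Gn \in unitmx by rewrite unitmxE detG unitr1.
have GV : G *m invmx Gn = input_mx by rewrite -GE mulmxK.
(* The feedback gain: [shift_mx - F] lives in the last block row, where [G] acts through the
   invertible [Gn], so [G *m K] can equal it. *)
pose K := invmx Gn *m (input_mx^T *m (shift_mx - F)).
have FK : F + G *m K = shift_mx.
  have PD : input_mx *m (input_mx^T *m (shift_mx - F)) = shift_mx - F.
    apply: input_mx_proj => i lt_i; apply/mxrowP => j.
    by rewrite -submxblockEv submxrow0 submxblockB mxblockK F_blk // subrr.
  by rewrite /K [G *m _]mulmxA GV PD addrC subrK.
pose T1 := block_mx 1%:M 0 (map_mx polyC K) 1%:M.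
pose T2 := block_mx 1%:M state_mx 0 ('X^nu *: map_mx polyC (invmx Gn)).
(* [T1] applies the feedback; [T2] turns the upper right block into
   [(sI - F0) X - s^nu G Gn^-1 = 0]. *)
have E : system_mx F G C *m T1 *m T2 =
    block_mx (char_poly_mx shift_mx) 0
      (map_mx polyC C) (map_mx polyC C *m state_mx).
  rewrite /system_mx /T1 !mulmx_block !mulmx1 !mulmx0 !mul0mx !addr0 !add0r.
  rewrite mulNmx -map_polyC_mxM -addrA -opprD -map_mxD FK.
  rewrite char_poly_mx_shift_state mulNmx -scalemxAr -map_polyC_mxM GV.
  by rewrite subrr mul0mx addr0.
have := congr1 determinant E; rewrite !det_mulmx det_lblock !det1 !mulr1.
rewrite det_ublock det1 mul1r detZ det_map_mx det_inv detG invr1 mulr1 -exprM.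
by rewrite det_lblock mul_state_mx -char_poly_shift_mx mulnC.
Qed.

End ShiftSystem.

(** * Rank increments of the controllability matrices *)

Section RankIncrements.
Variables (R : fieldType) (n r : nat) (A : 'M[R]_n) (B : 'M[R]_(n, r)).

(** Subspaces are row spaces, so the column space of the controllability matrix is handled through
    its transpose. *)
Local Notation S k := (\sum_(j < k) <<(A ^+ j *m B)^T>>)%MS.

Lemma rank_ctrb_sum k : \rank (ctrb_mx A B k) = \rank (S k).
Proof. by rewrite -mxrank_tr /ctrb_mx tr_mxrow eqmx_col. Qed.

Lemma ctrb_sum_mulr k : (S k *m A^T :=: \sum_(j < k) <<(A ^+ j.+1 *m B)^T>>)%MS.
Proof.
apply: (eqmx_trans (sumsmxMr _ _ _)); apply: eqmx_sums => i _.
apply: (eqmx_trans (eqmxMr _ (genmxE _))); apply: eqmx_sym.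
by rewrite exprS -mulmxE -mulmxA [(A *m _)^T]trmx_mul; apply: genmxE.
Qed.

Lemma ctrb_sum_recl k : (S k.+1 :=: B^T + S k *m A^T)%MS.
Proof.
rewrite big_ord_recl expr0 mul1mx; apply: adds_eqmx; first exact: genmxE.
exact/eqmx_sym/ctrb_sum_mulr.
Qed.

(** [S k.+2] lies in [W + W A^T], and [V A^T] lies in [W :&: W A^T], so the gain of [S k.+2] over
    [W] is at most [rank (W A^T) - rank (V A^T)]. By rank-nullity this is at most [rank W - rank V],
    since [W] meets the kernel of [A^T] in at least the dimension that [V] does. *)
Lemma rank_ctrb_concave k :
  (\rank (ctrb_mx A B k.+2) + \rank (ctrb_mx A B k)
     <= (\rank (ctrb_mx A B k.+1)).*2)%N.
Proof.
rewrite !rank_ctrb_sum; set V := S k; set W := S k.+1.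
have VW : (V <= W)%MS by rewrite /W big_ord_recr addsmxSl.
have BW : (B^T <= W)%MS by rewrite /W ctrb_sum_recl addsmxSl.
have VAW : (V *m A^T <= W)%MS by rewrite /W ctrb_sum_recl addsmxSr.
have SE : (S k.+2 <= W + W *m A^T)%MS.
  by rewrite (ctrb_sum_recl k.+1) addsmxS.
have capS : (\rank (V *m A^T) <= \rank (W :&: W *m A^T)%MS)%N.
  by apply: mxrankS; rewrite sub_capmx VAW submxMr.
have kerS : (\rank (V :&: kermx A^T)%MS <= \rank (W :&: kermx A^T)%MS)%N.
  exact/mxrankS/capmxS.
move: (mxrank_sum_cap W (W *m A^T)) (mxrank_mul_ker V A^T).
move: (mxrank_mul_ker W A^T) (mxrankS SE) capS kerS; lia.
Qed.

Lemma ctrb_incr_rank k :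
  ctrb_incr A B k = (\rank (ctrb_mx A B k.+1) - \rank (ctrb_mx A B k))%N.
Proof. by case: k => //=; rewrite rank_ctrb1 rank_ctrb0 subn0. Qed.

Lemma ctrb_incr_homo k : (ctrb_incr A B k.+1 <= ctrb_incr A B k)%N.
Proof. by rewrite !ctrb_incr_rank; move: (rank_ctrb_concave k); lia. Qed.

Lemma blk_homo (i j : 'I_(ctrb_index A B)) :
  i.+1 = j -> (blk A B i <= blk A B j)%N.
Proof.
move=> ij; rewrite /blk -ij -subnSK; first exact: ctrb_incr_homo.
by rewrite ij.
Qed.

Lemma blk_last (i : 'I_(ctrb_index A B)) :
  i.+1 = ctrb_index A B -> blk A B i = \rank B.
Proof. by move=> e; rewrite /blk e subnn. Qed.

End RankIncrements.

(** * System zeros of a square system *)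

Lemma incr_id k (f : {ffun 'I_k -> 'I_k}) : incr f -> forall i, f i = i.
Proof.
move=> incf.
have f_lt (i j : 'I_k) : (i < j)%N -> (f i < f j)%N.
  by move: incf => /forallP/(_ i)/forallP/(_ j)/implyP.
(* Gaps never shrink under [f]. Applied from [0] to [i] and from [i] to [k-1], this gives [i <= f i]
   and [f i <= i]. *)
have step d (i j : 'I_k) : j = (i + d)%N :> nat -> (f i + d <= f j)%N.
  elim: d j => [|d IHd] j ij.
    by rewrite addn0; have -> : j = i by apply: val_inj; rewrite /= ij addn0.
  have lt : (i + d < k)%N by move: (ltn_ord j); lia.
  have lt2 : (f (Ordinal lt) < f j)%N by apply: f_lt; rewrite ij addnS.
  by rewrite addnS; apply: leq_ltn_trans lt2; apply: IHd.
move=> i; apply: val_inj => /=.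
have k_gt0 : (0 < k)%N by apply: leq_ltn_trans (ltn_ord i).
have lt : (k.-1 < k)%N by rewrite prednK.
have := step i (Ordinal k_gt0) i erefl.
have := step (k.-1 - i)%N i (Ordinal lt).
move: (ltn_ord (f (Ordinal lt))) (ltn_ord i) => /=; lia.
Qed.

Lemma zero_multZ (R : rcfType) (c : R) (q : {poly R}) z : c != 0 ->
  zero_mult (c *: q) z = zero_mult q z.
Proof.
move=> c0; rewrite /zero_mult /complex_poly map_polyZ /= -mul_polyC.
by rewrite mupMr // rootC fmorph_eq0.
Qed.

(** As [det P] is nonzero, all [r] bordering rows and columns are taken; the identity is then the
    only increasing selection, and the gcd runs over a single minor. *)
Lemma system_zero_poly_square (R : fieldType) n r (A : 'M[R]_n)
    (B : 'M_(n, r)) (C : 'M_(r, n)) :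
  \det (system_mx A B C) != 0 ->
  system_zero_poly A B C = \det (system_mx A B C).
Proof.
move=> det0.
have borderE (f : {ffun 'I_r -> 'I_r}) : incr f -> border f =1 id.
  move=> incf i; rewrite /border -[RHS](splitK i).
  by case: (split i) => //= a; rewrite (incr_id _ _ incf).
have minorE (f g : {ffun 'I_r -> 'I_r}) :
    incr f -> incr g -> bminor A B C f g = \det (system_mx A B C).
  move=> incf incg; congr (\det _); apply/matrixP=> i j.
  by rewrite mxE !borderE.
pose id_r : {ffun 'I_r -> 'I_r} := [ffun i => i].
have inc_id : incr id_r.
  by apply/forallP => i; apply/forallP => j; rewrite !ffunE implybb.
have max_r : max_bminor A B C = r.
  have has_r : has_bminor A B C (@ord_max (minn r r)).
    rewrite /= minnn; apply/existsP; exists id_r; apply/existsP; exists id_r.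
    by rewrite inc_id minorE.
  apply/eqP; rewrite eqn_leq; apply/andP; split.
    apply/bigmax_leqP => i _; rewrite -ltnS; by case: i => i /=; rewrite minnn.
  rewrite -{1}[r]minnn.
  exact: (leq_bigmax_cond (P := fun k : 'I__ => has_bminor A B C k)
           (F := @nat_of_ord _) ord_max).
(* The index types depend on [max_bminor], so it is generalized before being replaced by [r]. *)
rewrite /system_zero_poly; move: (max_bminor A B C) max_r => k e; subst k.
have pred_id : (fun f : {ffun 'I_r -> 'I_r} => incr f) =1 pred1 id_r.
  move=> f; apply/idP/eqP => [incf|-> //].
  by apply/ffunP => i; rewrite ffunE (incr_id _ _ incf).
rewrite (big_pred1_id _ _ _ pred_id) gcdp0.
rewrite (big_pred1_id _ _ (i := id_r)) ?gcdp0 ?minorE //.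
by move=> g; rewrite -pred_id; apply/andb_idr => incg; rewrite minorE.
Qed.

(** * Change of coordinates and conclusion *)

Lemma det_system_mx_similar (R : fieldType) n r (A : 'M[R]_n) (B : 'M_(n, r))
    (C : 'M_(r, n)) (N : 'M_n) (M : 'M_r) :
  N \in unitmx ->
  \det (system_mx (N *m A *m invmx N) (N *m B *m M) (C *m invmx N)) =
  \det M *: \det (system_mx A B C).
Proof.
move=> Nu.
pose L := block_mx (map_mx polyC N) 0 0 (1%:M : 'M_r).
pose U := block_mx (map_mx polyC (invmx N)) 0 0 (map_mx polyC M).
have -> : system_mx (N *m A *m invmx N) (N *m B *m M) (C *m invmx N) =
    L *m system_mx A B C *m U.
  rewrite /system_mx !mulmx_block !mul0mx !mulmx0 !mul1mx !addr0 !add0r mul0mx.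
  rewrite mulmxBr mulmxBl -!map_polyC_mxM mulmxN mulNmx -!map_polyC_mxM.
  congr (block_mx (_ - _) _ _ _).
  by rewrite mul_mx_scalar -scalemxAl -map_polyC_mxM mulmxV // map_mx1 scalemx1.
(* The determinants of [N] and its inverse cancel, and [det M] remains. *)
rewrite !det_mulmx !det_lblock !det_map_mx det1 mulr1 det_inv -mul_polyC.
have Nd : \det N != 0 by rewrite -unitfE -unitmxE.
rewrite mulrC mulrA; congr (_ * _).
by rewrite -!polyCM mulrAC mulVf ?mul1r.
Qed.

Lemma det_system_mx_cast (R : fieldType) n n' r (e : n = n') (A : 'M[R]_n)
    (B : 'M_(n, r)) (C : 'M_(r, n)) :
  \det (system_mx (castmx (e, e) A) (castmx (e, erefl r) B)
          (castmx (erefl r, e) C)) = \det (system_mx A B C).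
Proof. by case: n' / e; rewrite !castmx_id. Qed.

(** The exponent [n - r nu] may be negative, so the polynomial identity has to be divided in a
    field, here meant to be the fraction field. *)
Lemma exprz_sub_solve (F : fieldType) (x a b : F) (n m : nat) :
  x != 0 -> a * x ^+ m = x ^+ n * b -> a = x ^ (n%:Z - m%:Z) * b.
Proof.
move=> x0 E; rewrite expfzDr // mulrAC -exprnP -E -exprnN mulfK //.
exact: expf_neq0.
Qed.

Lemma det_dim0 (R : comNzRingType) n (A : 'M[R]_n) : n = 0%N -> \det A = 1.
Proof. by move=> n0; subst n; apply: det_mx00. Qed.

Lemma det_system_mx_yokoyama (R : fieldType) n r (A : 'M[R]_n) (B : 'M_(n, r))
    (C : 'M_(r, n)) (rkB : \rank B = r) (cAB : controllable A B) N M :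
  yokoyama_form cAB N M ->
  (\det M *: \det (system_mx A B C)) * 'X^(r * ctrb_index A B) =
  'X^n * \det (C_tilde cAB C N).
Proof.
case=> Nu _ F_blk G0 G_last.
rewrite -(det_system_mx_similar _ _ _ _ _ _ _ _ Nu).
(* Without blocks there is no last one: [nu = 0] forces [n = 0] by controllability, then [r = 0] by
   the rank of [B], and both determinants are 1. *)
have [nu0|nu_gt0] := posnP (ctrb_index A B).
  have n0 : n = 0%N.
    have := eqn_blk cAB; rewrite big1 // => i _.
    by have := leq_trans (ltn_ord i) (eq_leq nu0).
  have Xn : 'X^n = 1 :> {poly R} by rewrite n0.
  have r0 : r = 0%N by apply/eqP; rewrite -leqn0 -n0 -{1}rkB rank_leq_row.
  rewrite [\det (C_tilde _ _ _)]det_dim0 // det_dim0 ?n0 ?r0 //.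
  by rewrite nu0 muln0 Xn mulr1.
rewrite -(det_system_mx_cast _ _ _ _ (eqn_blk cAB)) det_system_mx_blocks //.
- by congr ('X^_ * _); rewrite -eqn_blk.
- by move=> i /blk_last ->.
- by move=> i j; apply: blk_homo.
Qed.

Theorem theorem7p1 (R : realType) (n r : nat)
    (A : 'M[R]_n) (B : 'M[R]_(n, r)) (C : 'M[R]_(r, n))
    (rkB : \rank B = r)
    (cAB : controllable A B)
    (rkP : normal_rank A B C = (n + r)%N)
    (N : 'M[R]_n) (M : 'M[R]_r)
    (hNM : yokoyama_form cAB N M) :
  exists psi : {poly R},
    tofrac psi =
      tofrac 'X ^ (n%:Z - (r * ctrb_index A B)%N%:Z)
        * tofrac (\det (C_tilde cAB C N))
    /\ forall z : R[i],
         (is_zero (system_zero_poly A B C) z <-> is_zero psi z)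
         /\ zero_mult (system_zero_poly A B C) z = zero_mult psi z.
Proof.
have [_ /is_perm_mxP[s Ms] _ _ _] := hNM.
(* Full normal rank makes [P] invertible over the fraction field. *)
have detP0 : \det (system_mx A B C) != 0.
  have : map_mx (@tofrac {poly R}) (system_mx A B C) \in unitmx.
    by rewrite -row_free_unit /row_free -/(normal_rank A B C) rkP.
  by rewrite unitmxE det_map_mx unitfE tofrac_eq0.
have detM0 : \det M != 0 by rewrite Ms det_perm signr_eq0.
(* The quotient is thus a genuine polynomial, and the nonzero constant [det M] changes neither zeros
   nor multiplicities. *)
exists (\det M *: \det (system_mx A B C)); split.
  have X0 : tofrac 'X != 0 :> {fraction {poly R}}.
    by rewrite tofrac_eq0 polyX_eq0.
  apply: exprz_sub_solve X0 _; rewrite -!tofracXn -!tofracM.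
  by rewrite (det_system_mx_yokoyama _ _ _ _ _ C rkB cAB _ _ hNM).
move=> z; rewrite system_zero_poly_square // zero_multZ //.
by rewrite /is_zero /complex_poly map_polyZ rootZ // fmorph_eq0.
Qed.
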